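(* Let $U\subseteq\mathbb{R}^m\times\mathbb{R}^s$ be open, let $\mathfrak{g}\colon U\to\mathbb{R}^s$ be a $C^\infty$ map such that the partial derivative $\partial_2\mathfrak{g}(x,y)$ (with respect to $y\in\mathbb{R}^s$) is invertible for all $(x,y)\in U$, and let $M=\mathfrak{g}^{-1}(0)$. Let $TU=U\times(\mathbb{R}^m\times\mathbb{R}^s)$ and let $\mathcal{E}\colon\mathbb{R}\times TU\to\mathbb{R}^m$ be continuous. For $t\in\mathbb{R}$ and $(p,q,u,v)\in TU$ (with $p,u\in\mathbb{R}^m$, $q,v\in\mathbb{R}^s$) put $$\widetilde{\mathcal{E}}(t,p,q,u,v)=\begin{pmatrix}\mathcal{E}(t,p,q,u,v)\\ -\big[\partial_2\mathfrak{g}(p,q)\big]^{-1}\Big(\partial_1\mathfrak{g}(p,q)\,\mathcal{E}(t,p,q,u,v)+\mathfrak{g}''(p,q)\big((u,v),(u,v)\big)\Big)\end{pmatrix}\in\mathbb{R}^m\times\mathbb{R}^s.$$ Then the differential-algebraic equation $$\begin{cases}\ddot x=\mathcal{E}(t,x,y,\dot x,\dot y),\\ \mathfrak{g}(x,y)=0,\end{cases}$$ is equivalent to the second order ordinary differential equation on $M$ $$\ddot\xi_\pi=\mathcal{P}_\xi\,\widetilde{\mathcal{E}}(t,\xi,\dot\xi),$$ in the sense that $(x(t),y(t))$ is a solution of the former if and only if $\xi(t)=(x(t),y(t))$ is a solution of the latter. Here $\mathcal{P}_{(p,q)}$ denotes the orthogonal projection of $\mathbb{R}^m\times\mathbb{R}^s$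 onto $T_{(p,q)}M$.
   Context: $M$ is a smooth $m$-dimensional submanifold of $\mathbb{R}^k=\mathbb{R}^m\times\mathbb{R}^s$. $\mathfrak{g}''(p,q)$ denotes the second Fréchet derivative of $\mathfrak{g}$ at $(p,q)$, a symmetric bilinear map. A solution of the differential-algebraic equation is a pair of $C^1$ functions $x\colon J\to\mathbb{R}^m$, $y\colon J\to\mathbb{R}^s$, $J$ a (nontrivial) interval, with $(x(t),y(t))\in U$, $\ddot x(t)=\mathcal{E}(t,x(t),y(t),\dot x(t),\dot y(t))$ and $\mathfrak{g}(x(t),y(t))=0$ for all $t\in J$ (in particular $\ddot x$ exists on $J$). For a $C^2$ curve $\xi$ in $M$, $\ddot\xi_\pi(t)$ is the orthogonal projection of $\ddot\xi(t)\in\mathbb{R}^k$ onto $T_{\xi(t)}M$. A solution of the equation on $M$ is a $C^2$ map $\xi\colon J\to M$, $J$ a nontrivial interval, with $\ddot\xi_\pi(t)=\mathcal{P}_{\xi(t)}\widetilde{\mathcal{E}}(t,\xi(t),\dot\xi(t))$ for all $t\in J$. *)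

(* Defs.v *)
(* MathComp-Analysis; R^m is 'rV[R]_m and R^m x R^s is 'rV[R]_m * 'rV[R]_s.
   Functions on U, U x (R^m x R^s) or J are total functions of which only the
   values on the stated domain matter. *)
From HB Require Import structures.
From mathcomp Require Import all_boot all_order all_algebra.
From mathcomp Require Import all_classical all_reals all_analysis.
Set Implicit Arguments.
Unset Strict Implicit.
Unset Printing Implicit Defensive.
Import Order.TTheory GRing.Theory Num.Theory numFieldNormedType.Exports.
Local Open Scope classical_set_scope.
Local Open Scope ring_scope.

(* Derivatives along an interval J: the difference quotient is restricted to J,
   so that the derivative is one-sided at an end point belonging to J. *)
Section curves.
Context {R : realType} {V : normedModType R}.
Implicit Types (J : set R) (f : R -> V) (t : R).

Definition slope f t : R -> V := fun r => (r - t)^-1 *: (f r - f t).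

Definition derivable_on J f t : Prop := cvg (slope f t @ within J t^').

Definition derive_on J f : R -> V := fun t => lim (slope f t @ within J t^').

Definition C1_on J f : Prop :=
  (forall t, J t -> derivable_on J f t) /\ {within J, continuous (derive_on J f)}.

Definition C2_on J f : Prop := C1_on J f /\ C1_on J (derive_on J f).

End curves.

Definition nontrivial_interval {R : realType} (J : set R) : Prop :=
  is_interval J /\ exists a b, [/\ J a, J b & a < b].

(* In finite dimension, f is C^(n+1) on the open set U iff it is differentiable
   on U and z |-> Df(z) v is C^n for every fixed vector v. *)
Fixpoint Cn_on {R : realType} {V W : normedModType R}
    (n : nat) (U : set V) (f : V -> W) : Prop :=
  if n is k.+1 then
    (forall z, U z -> differentiable f z) /\
    (forall v, Cn_on k U (fun z => 'd f z v))
  else {within U, continuous f}.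

Definition smooth_on {R : realType} {V W : normedModType R}
    (U : set V) (f : V -> W) : Prop := forall n, Cn_on n U f.

(* f''(z)(a, b) = (D(Df)(z) a) b, where evaluation at b has been moved inside
   the outer derivative. *)
Definition diff2 {R : realType} {V W : normedModType R}
    (f : V -> W) (z a b : V) : W := 'd (fun w => 'd f w b) z a.

Section dae.
Context {R : realType} {m s : nat}.
Local Notation X := 'rV[R]_m.
Local Notation Y := 'rV[R]_s.
Local Notation Z := ('rV[R]_m * 'rV[R]_s)%type.

(* Jacobian matrices in the library's row-vector convention: the partial
   derivative sends u to u *m partial1 g z, resp. v to v *m partial2 g z. *)
Definition partial1 (g : Z -> Y) (z : Z) : 'M[R]_(m, s) :=
  'J (fun x : X => g (x, z.2)) z.1.

Definition partial2 (g : Z -> Y) (z : Z) : 'M[R]_s :=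
  'J (fun y : Y => g (z.1, y)) z.2.

Definition zero_set (U : set Z) (g : Z -> Y) : set Z :=
  [set z | U z /\ g z = 0].

(* T_z M: velocities at z of C^1 curves lying in M. *)
Definition tangent_space (M : set Z) (z : Z) : set Z :=
  [set w | exists (e : R) (c : R -> Z),
    [/\ 0 < e, C1_on `]-e, e[ c, (forall t, t \in `]-e, e[ -> M (c t)), c 0 = z
      & derive_on `]-e, e[ c 0 = w]].

Definition dot (a b : Z) : R :=
  \sum_i a.1 0 i * b.1 0 i + \sum_j a.2 0 j * b.2 0 j.

(* The point v of T with w - v orthogonal to T; it exists and is unique when T
   is a linear subspace (the value 0 is a junk default otherwise). *)
Definition orth_proj (T : set Z) (w : Z) : Z :=
  xget 0 [set v | T v /\ forall a, T a -> dot (w - v) a = 0].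

Definition Etilde (g : Z -> Y) (E : R * (Z * Z) -> X) (a : R * (Z * Z)) : Z :=
  let: (_, (z, w)) := a in
  (E a,
   - ((E a *m partial1 g z + diff2 g z w w) *m invmx (partial2 g z))).

Definition dae_solution (U : set Z) (g : Z -> Y) (E : R * (Z * Z) -> X)
    (J : set R) (x : R -> X) (y : R -> Y) : Prop :=
  [/\ nontrivial_interval J, C1_on J x, C1_on J y &
      forall t, J t ->
        [/\ U (x t, y t),
            derivable_on J (derive_on J x) t,
            derive_on J (derive_on J x) t =
              E (t, ((x t, y t), (derive_on J x t, derive_on J y t)))
          & g (x t, y t) = 0]].

Definition ode_solution (M : set Z) (F : R * (Z * Z) -> Z)
    (J : set R) (xi : R -> Z) : Prop :=
  [/\ nontrivial_interval J, C2_on J xi, (forall t, J t -> M (xi t)) &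
      forall t, J t ->
        orth_proj (tangent_space M (xi t)) (derive_on J (derive_on J xi) t) =
        orth_proj (tangent_space M (xi t)) (F (t, (xi t, derive_on J xi t)))].

End dae.

(* Main.v *)
Require Import Defs.
From HB Require Import structures.
From mathcomp Require Import all_boot all_order all_algebra.
From mathcomp Require Import all_classical all_reals all_analysis.
From mathcomp Require Import lra.
Set Implicit Arguments.
Unset Strict Implicit.
Unset Printing Implicit Defensive.
Import Order.TTheory GRing.Theory Num.Theory numFieldNormedType.Exports.
Local Open Scope classical_set_scope.
Local Open Scope ring_scope.

(** Write z = (p, q) for a point of M, P1 and P2 for the two Jacobians of g at
    z, acting on row vectors from the right, and K = - P1 P2^-1.  Three facts
    give the equivalence.

    The constraint determines the y-part of the acceleration.  Along a curve xi
    in M with velocity w one has g'(xi) w = 0, and differentiating this once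
    more gives x'' P1 + y'' P2 + g''(xi)(w, w) = 0, which is solved for y'' by
    inverting P2: a curve in M whose velocity has a differentiable first
    component has acceleration (x'', - (x'' P1 + g''(xi)(w, w)) P2^-1)
    ([acceleration_snd]).  This includes the existence of y'', as the relation
    is obtained for difference quotients before the limit is taken.  Hence a
    solution of the differential-algebraic equation satisfies
    xi'' = Etilde(t, xi, xi'), without any projection; the right-hand side is
    continuous, so that xi is C^2, and projecting gives the equation on M.

    The tangent space, defined by velocities of curves in M, is the kernel of
    g'(z), that is, the graph of K ([tangent_space_graph]).  That velocities lie
    in the kernel is the first differentiation above.  Conversely, (u, u K) is
    the velocity of t |-> (p + t u, phi (p + t u)), where phi is the implicit
    function of g near z ([implicit_function]); phi is a fixed point of the
    simplified Newton map y |-> y - g(x, y) P2^-1, a contraction because g is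
    strictly differentiable at z ([strictly_differentiable]).

    The orthogonal projection onto a graph exists, because the matrix
    1 + K K^T is invertible, so that two vectors which differ by an element of
    the graph and have the same projection are equal ([orth_proj_graph_inj]).
    For a curve xi in M the first fact says that xi'' and Etilde(t, xi, xi')
    differ by an element of the graph.  If xi solves the equation on M they
    have the same projection; therefore they are equal, and the first component
    of this equality is x'' = E. *)

(** * Limits of matrices and of linear maps *)

Section matrix_limits.
Context {R : realType} {T : Type} {F : set_system T} {FF : Filter F}.

Lemma cvg_mx m n (A : T -> 'M[R]_(m, n)) (B : 'M[R]_(m, n)) :
  (forall i j, A t i j @[t --> F] --> B i j) -> A @ F --> B.
Proof.
move=> AB S [P BP PS].
have FP : F [set t | forall i j, P i j (A t i j)].
  by apply: filter_forall => i; apply: filter_forall => j; exact: AB (BP i j).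
by apply: (@filterS _ F) FP => t Pt; apply: PS.
Qed.

Lemma cvg_entry m n (A : T -> 'M[R]_(m, n)) (B : 'M[R]_(m, n)) i j :
  A @ F --> B -> A t i j @[t --> F] --> B i j.
Proof.
move=> AB; exact: (cvg_comp _ _ AB (@coord_continuous _ _ _ i j B)).
Qed.

Lemma cvg_sumr (I : Type) (r : seq I) (P : pred I) (V : normedModType R)
    (f : I -> T -> V) (l : I -> V) :
  (forall i, P i -> f i @ F --> l i) ->
  \sum_(i <- r | P i) f i t @[t --> F] --> \sum_(i <- r | P i) l i.
Proof.
move=> fl; apply: cvg_big => //; exact: add_continuous.
Qed.

Lemma cvg_prodr (I : Type) (r : seq I) (P : pred I)
    (f : I -> T -> R) (l : I -> R) :
  (forall i, P i -> f i @ F --> l i) ->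
  \prod_(i <- r | P i) f i t @[t --> F] --> \prod_(i <- r | P i) l i.
Proof.
move=> fl; apply: cvg_big => //; exact: mul_continuous.
Qed.

Lemma cvg_mulmx m n p (A : T -> 'M[R]_(m, n)) (B : T -> 'M[R]_(n, p))
    (a : 'M[R]_(m, n)) (b : 'M[R]_(n, p)) :
  A @ F --> a -> B @ F --> b -> A t *m B t @[t --> F] --> a *m b.
Proof.
move=> Aa Bb; apply: cvg_mx => i j; rewrite mxE.
under eq_cvg do rewrite mxE.
by apply: cvg_sumr => k _; apply: cvgM; apply: cvg_entry.
Qed.

Lemma cvg_det n (A : T -> 'M[R]_n) (a : 'M[R]_n) :
  A @ F --> a -> \det (A t) @[t --> F] --> \det a.
Proof.
move=> Aa; apply: cvg_sumr => s _; apply: cvgM; first exact: cvg_cst.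
by apply: cvg_prodr => i _; apply: cvg_entry.
Qed.

(** By Cramer's rule the inverse is a rational function of the entries, with
    denominator the determinant. *)
Lemma cvg_invmx n (A : T -> 'M[R]_n) (a : 'M[R]_n) : a \in unitmx ->
  A @ F --> a -> invmx (A t) @[t --> F] --> invmx a.
Proof.
move=> ua Aa; have da : \det a != 0 by rewrite -unitfE -unitmxE.
have Ad := cvg_det Aa.
(* The formula of Cramer's rule holds near the limit, as the determinant is
   nonzero there. *)
have uA : \forall t \near F, (\det (A t))^-1 *: \adj (A t) = invmx (A t).
  near=> t; rewrite /invmx unitmxE unitfE ifT//.
  by near: t; exact: (cvgr_neq0 _ Ad).
apply: cvg_trans (near_eq_cvg uA) _; rewrite /invmx ua.
apply: cvgZ; first exact: cvgV.
apply: cvg_mx => i j; rewrite !mxE; under eq_cvg do rewrite mxE.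
apply: cvgM; first exact: cvg_cst.
apply: cvg_det; apply: cvg_mx => k l; rewrite !mxE.
by under eq_cvg do rewrite !mxE; exact: cvg_entry.
Unshelve. all: by end_near. Qed.

End matrix_limits.

Section norms.
Context {R : realType}.

Lemma le_mx_norm_entry k l (A : 'M[R]_(k, l)) i j : `|A i j| <= `|A|.
Proof.
rewrite [leRHS]/Num.Def.normr/= mx_normrE.
exact: (le_bigmax _ (fun ij => `|A ij.1 ij.2|) (i, j)).
Qed.

Lemma mx_norm_le k l (A : 'M[R]_(k, l)) (e : R) : 0 <= e ->
  (forall i j, `|A i j| <= e) -> `|A| <= e.
Proof.
move=> e0 Ae; rewrite /Num.Def.normr/= mx_normrE.
by apply: bigmax_le => // -[i j] _; exact: Ae.
Qed.

End norms.

Lemma ball_pair {R : realType} {V W : normedModType R} (z : V * W) (x : V)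
    (y : W) (r : R) :
  `|z.1 - x| < r -> `|z.2 - y| < r -> `|z - (x, y)| < r.
Proof. by move=> zx zy; rewrite prod_normE/= gt_max zx zy. Qed.

Section opbound.
Context {R : realType} {m s : nat} {W : normedModType R}.
Local Notation Z := ('rV[R]_m * 'rV[R]_s)%type.
Implicit Types f : Z -> W.

(** For linear maps, an upper bound of the operator norm that involves only the
    values at the standard basis vectors. *)
Definition opbound f : R :=
  \sum_i `|f (delta_mx 0 i, 0)| + \sum_j `|f (0, delta_mx 0 j)|.

Lemma opbound_ge0 f : 0 <= opbound f.
Proof. by rewrite addr_ge0// sumr_ge0. Qed.

Lemma linear_le_opbound f h : linear f -> `|f h| <= opbound f * `|h|.
Proof.
move=> lf.
pose fM := GRing.isLinear.Build _ _ _ _ _ lf.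
pose fL : {linear Z -> W} := HB.pack f fM.
have -> : f = fL by [].
case: h => u v.
have uE : (u, 0) = \sum_i u 0 i *: (delta_mx 0 i, 0) :> Z.
  rewrite {1}(row_sum_delta u).
  rewrite (big_morph (fun x => (x, 0) : Z) (id1 := 0) (op1 := +%R))//.
    by apply: eq_bigr => i _; rewrite -[RHS]/(_ *: _, _ *: 0) scaler0.
  by move=> x y; rewrite -[RHS]/(_ + _, _ + _) addr0.
have vE : (0, v) = \sum_j v 0 j *: (0, delta_mx 0 j) :> Z.
  rewrite {1}(row_sum_delta v).
  rewrite (big_morph (fun x => (0, x) : Z) (id1 := 0) (op1 := +%R))//.
    by apply: eq_bigr => i _; rewrite -[RHS]/(_ *: 0, _ *: _) scaler0.
  by move=> x y; rewrite -[RHS]/(_ + _, _ + _) addr0.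
have nu : `|u| <= `|(u, v)| by rewrite prod_normE/= le_max lexx.
have nv : `|v| <= `|(u, v)| by rewrite prod_normE/= le_max lexx orbT.
move: (`|(u, v)|) nu nv => N nu nv.
have -> : (u, v) = (u, 0) + (0, v) :> Z.
  by rewrite -[RHS]/(_ + _, _ + _) addr0 add0r.
rewrite linearD (le_trans (ler_normD _ _))// mulrDl; apply: lerD.
  rewrite uE linear_sum (le_trans (ler_norm_sum _ _ _))// mulr_suml.
  rewrite ler_sum// => i _; rewrite linearZ/= normrZ mulrC ler_wpM2l//.
  by rewrite (le_trans (le_mx_norm_entry u 0 i)).
rewrite vE linear_sum (le_trans (ler_norm_sum _ _ _))// mulr_suml.
rewrite ler_sum// => i _; rewrite linearZ/= normrZ mulrC ler_wpM2l//.
by rewrite (le_trans (le_mx_norm_entry v 0 i)).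
Qed.

(** In finite dimension pointwise convergence of linear maps is convergence in
    norm.  Thus continuity of z |-> g'(z) v for each fixed v makes g' continuous
    in norm. *)
Lemma opbound_cvg0 (T : Type) (F : set_system T) {FF : Filter F}
    (L : T -> Z -> W) (l : Z -> W) :
  (forall e, L t e @[t --> F] --> l e) ->
  opbound (L t - l) @[t --> F] --> (0 : R).
Proof.
move=> Ll.
have L0 e : `|(L t - l) e| @[t --> F] --> (0 : R).
  rewrite -(@normr0 _ W) -(subrr (l e)).
  by apply: cvg_norm; apply: cvgB => //; exact: cvg_cst.
have E : (0 : R) = \sum_(i < m) 0 + \sum_(j < s) 0 by rewrite !big1 ?addr0.
by rewrite [X in _ --> X]E; apply: cvgD; apply: cvg_sumr.
Qed.

Lemma linear_sub (f l : Z -> W) : linear f -> linear l -> linear (f - l).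
Proof.
move=> lf ll a x y.
by rewrite !fctE lf ll scalerBr opprD addrACA.
Qed.

(** Convergence in norm allows the argument to move together with the map. *)
Lemma cvg_linear_app (T : Type) (F : set_system T) {FF : Filter F}
    (L : T -> Z -> W) (l : Z -> W) (w : T -> Z) (v : Z) :
  (\forall t \near F, linear (L t)) -> linear l ->
  (forall e, L t e @[t --> F] --> l e) -> w @ F --> v ->
  L t (w t) @[t --> F] --> l v.
Proof.
move=> lL ll Ll wv.
have wv0 : `|w t - v| @[t --> F] --> (0 : R).
  rewrite -(@normr0 _ Z) -(subrr v).
  by apply: cvg_norm; apply: cvgB => //; exact: cvg_cst.
have B0 : opbound (L t - l) * `|w t| + opbound l * `|w t - v| @[t --> F] -->
    (0 : R).
  rewrite -[X in _ --> X](addr0 0) -[X in _ --> X + _](mul0r `|v|).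
  rewrite -[X in _ --> _ + X](mulr0 (opbound l)).
  apply: cvgD; apply: cvgM => //; first exact: opbound_cvg0.
    exact: cvg_norm.
  exact: cvg_cst.
apply: cvg_sub0 (cvg_cst (l v)).
apply/norm_cvg0P; apply: squeeze_cvgr (cvg_cst (0 : R)) B0.
near=> t; rewrite normr_ge0/=.
have lLt : linear (L t) by near: t.
rewrite [X in `|X|](_ : _ = (L t - l) (w t) + l (w t - v)).
  rewrite (le_trans (ler_normD _ _))// lerD// linear_le_opbound//.
  exact: linear_sub.
have lE : l (w t) = l (w t - v) + l v.
  by rewrite -{1}(subrK v (w t)) -[w t - v]scale1r ll !scale1r.
by rewrite !fctE lE opprD addrAC addrA addrK.
Unshelve. all: by end_near. Qed.

End opbound.

(** * Derivatives along an interval *)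

Section within_interval.
Context {R : realType}.
Implicit Types (J : set R) (t : R).

(** The limits that define derivatives along J are limits along a proper filter,
    hence unique: a point of a nontrivial interval is an accumulation point of
    it, including the end points. *)
Lemma within_dnbhs_proper J t : nontrivial_interval J -> J t ->
  ProperFilter (within J t^').
Proof.
move=> [iJ [a [b [Ja Jb ab]]]] Jt; apply: Build_ProperFilter_ex.
move=> A [e /= e0 eA].
have [c Jc ct] : exists2 c, J c & c != t.
  have [at_|bt] := eqVneq a t; last by exists a.
  by exists b => //; rewrite -at_ gt_eqF.
have ct0 : 0 < `|c - t| by rewrite normr_gt0 subr_eq0.
(* The point t + d (c - t) is between t and c, and within e / 2 of t. *)
pose d := Num.min 1 (e / 2 / `|c - t|).
have d0 : 0 < d by rewrite lt_min ltr01/= !divr_gt0.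
have d1 : d <= 1 by rewrite ge_min lexx.
have de : d <= e / 2 / `|c - t| by rewrite ge_min lexx orbT.
exists (t + d * (c - t)); apply: eA.
- rewrite /ball_/= opprD addrA subrr sub0r normrN normrM (gtr0_norm d0).
  rewrite -ltr_pdivlMr// (le_lt_trans de)// ltr_pM2r ?invr_gt0//.
  by rewrite ltr_pdivrMr// ltr_pMr// ltr1n.
- by rewrite -subr_eq0 addrAC subrr add0r mulf_neq0 ?subr_eq0// gt_eqF.
- have [ltct|ltct] := leP c t.
    apply: (iJ _ _ Jc Jt (t + d * (c - t))); apply/andP; split; nra.
  apply: (iJ _ _ Jt Jc (t + d * (c - t))); apply/andP; split; nra.
Qed.

Lemma within_dnbhs_cvg J t : within J t^' --> within J (nbhs t).
Proof.
move=> A; apply: (@filterS _ (nbhs t)) => r Ar rt Jr; exact: Ar.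
Qed.

Lemma oo_nontrivial_interval (e : R) : 0 < e ->
  nontrivial_interval [set` `]-e, e[].
Proof.
move=> e0; split; first exact: interval_is_interval.
by exists 0, (e / 2); split; rewrite /= ?in_itv/=; lra.
Qed.

End within_interval.

Section derivative_along.
Context {R : realType}.
Implicit Types (V W : normedModType R) (J : set R) (t : R).

Definition is_derive_on V J (f : R -> V) t (l : V) : Prop :=
  slope f t @ within J t^' --> l.

Lemma derivable_is_derive_on V J (f : R -> V) t :
  derivable_on J f t -> is_derive_on J f t (derive_on J f t).
Proof. by []. Qed.

Lemma is_derive_on_derivable V J (f : R -> V) t l :
  is_derive_on J f t l -> derivable_on J f t.
Proof. by move=> fl; apply/cvg_ex; exists l. Qed.

Lemma is_derive_on_derive V J (f : R -> V) t l : nontrivial_interval J -> J t ->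
  is_derive_on J f t l -> derive_on J f t = l.
Proof.
move=> nJ Jt fl; have PF := within_dnbhs_proper nJ Jt.
by apply: cvg_lim => //; exact: norm_hausdorff.
Qed.

Lemma slopeP V (f : R -> V) t r : (r - t) *: slope f t r = f r - f t.
Proof.
have [->|rt] := eqVneq r t; first by rewrite !subrr scale0r.
by rewrite /slope scalerA divff ?scale1r// subr_eq0.
Qed.

Lemma eq_is_derive_on V J (f h : R -> V) t l : J t ->
  (forall r, J r -> f r = h r) -> is_derive_on J f t l -> is_derive_on J h t l.
Proof.
move=> Jt fh; apply: cvg_trans; apply: near_eq_cvg.
by near=> r; rewrite /slope !fh//; near: r; exact: withinT.
Unshelve. all: by end_near. Qed.

Lemma is_derive_on_pair V W J (x : R -> V) (y : R -> W) t (a : V) (b : W) :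
  is_derive_on J x t a -> is_derive_on J y t b ->
  is_derive_on J (fun r => (x r, y r)) t (a, b).
Proof. by move=> xa yb; apply: (cvg_pair xa yb). Qed.

Lemma is_derive_on_fst V W J (f : R -> V * W) t l :
  is_derive_on J f t l -> is_derive_on J (fun r => (f r).1) t l.1.
Proof. by move=> fl; apply: (cvg_comp _ _ fl cvg_fst). Qed.

Lemma is_derive_on_snd V W J (f : R -> V * W) t l :
  is_derive_on J f t l -> is_derive_on J (fun r => (f r).2) t l.2.
Proof. by move=> fl; apply: (cvg_comp _ _ fl cvg_snd). Qed.

Lemma is_derive_on_continuous V J (f : R -> V) t l :
  is_derive_on J f t l -> f @ within J (nbhs t) --> f t.
Proof.
move=> fl; apply: cvg_sub0 (cvg_cst (f t)).
have f0 : (r - t) *: slope f t r @[r --> within J t^'] --> (0 : V).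
  rewrite -[X in _ --> X](scale0r l); apply: cvgZ => //.
  rewrite -(subrr t); apply: cvgB; last exact: cvg_cst.
  by apply: cvg_trans (@within_dnbhs_cvg _ J t) _; exact: cvg_within.
apply/cvgr0Pnorm_lt => e e0.
move/cvgr0Pnorm_lt : f0 => /(_ e e0); rewrite !near_withinE.
apply: filterS => r re Jr; have [->|rt] := eqVneq r t.
  by rewrite !fctE subrr normr0.
by rewrite !fctE -slopeP; exact: re.
Qed.

(** The definition of differentiability with the Landau symbol expanded. *)
Lemma diff_near V W (h : V -> W) (z : V) : differentiable h z ->
  forall e, 0 < e ->
  \forall w \near z, `|h w - h z - 'd h z (w - z)| <= e * `|w - z|.
Proof.
case=> -[_ /eqaddoP hz] e e0; have := hz e e0.
by rewrite lim_id//; apply: filterS => w; rewrite !fctE/= opprD addrA.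
Qed.

(** The chain rule holds along J because the error of the linear approximation
    of h is small compared to f r - f t, and the slope of f is bounded. *)
Lemma is_derive_on_comp V W J (f : R -> V) (h : V -> W) t l :
  differentiable h (f t) -> is_derive_on J f t l ->
  is_derive_on J (h \o f) t ('d h (f t) l).
Proof.
move=> dh fl; have fc := is_derive_on_continuous fl.
apply: cvg_sub0 (_ : 'd h (f t) (slope f t r) @[r --> within J t^'] --> _);
  last first.
  have dc : continuous ('d h (f t)) by exact: diff_continuous.
  exact: (cvg_comp _ _ fl (dc l)).
have fb : \forall r \near within J t^', `|slope f t r| <= `|l| + 1.
  by apply: (cvgr_norm_le l fl); rewrite ltrDl.
apply/cvgr0Pnorm_le => e e0.
have M0 : 0 < `|l| + 1 by rewrite ltr_wpDl.
have eM : 0 < e / (`|l| + 1) by rewrite divr_gt0.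
have hf : \forall r \near within J t^',
    `|h (f r) - h (f t) - 'd h (f t) (f r - f t)| <=
    e / (`|l| + 1) * `|f r - f t|.
  have /= := cvg_trans (cvg_app f (@within_dnbhs_cvg _ J t)) fc.
  by move/(_ _ (diff_near dh eM)).
near=> r; rewrite !fctE.
have -> : slope (h \o f) t r - 'd h (f t) (slope f t r) =
   (r - t)^-1 *: (h (f r) - h (f t) - 'd h (f t) (f r - f t)).
  by rewrite /slope linearZ/= -scalerBr.
rewrite normrZ; apply: (@le_trans _ _ (e / (`|l| + 1) * `|slope f t r|)).
  by rewrite /slope normrZ mulrCA ler_wpM2l//; near: r.
apply: (@le_trans _ _ (e / (`|l| + 1) * (`|l| + 1))); last first.
  by rewrite divfK// gt_eqF.
by apply: ler_wpM2l; [exact: ltW|near: r; exact: fb].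
Unshelve. all: by end_near. Qed.

Lemma is_derive_on_affine V J (p u : V) t :
  is_derive_on J (fun r => p + r *: u) t u.
Proof.
apply: cvg_near_cst; rewrite !near_withinE; near=> r => rt _.
rewrite /slope opprD addrACA subrr add0r -scalerBl scalerA mulVf ?scale1r//.
by rewrite subr_eq0.
Unshelve. all: by end_near. Qed.

Lemma eq_within_continuous V J (f h : R -> V) :
  (forall r, J r -> f r = h r) ->
  (forall t, J t -> h @ within J (nbhs t) --> h t) -> {within J, continuous f}.
Proof.
move=> fh hc; apply/subspace_continuousP => t Jt.
rewrite -[X in _ --> X]/(f t) fh//.
apply: cvg_trans _ (hc t Jt); apply: near_eq_cvg; near=> r.
by apply/esym/fh; near: r; exact: withinT.
Unshelve. all: by end_near. Qed.

End derivative_along.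

(** * Differentials of smooth maps on a product *)

Section partials.
Context {R : realType} {m s : nat}.
Local Notation X := 'rV[R]_m.
Local Notation Y := 'rV[R]_s.
Local Notation Z := ('rV[R]_m * 'rV[R]_s)%type.
Implicit Types (g : Z -> Y) (z : Z).

Lemma diff_partial1 g z u : differentiable g z ->
  'd g z (u, 0) = u *m partial1 g z.
Proof.
case: z => p q dg; rewrite mul_rV_lin1/=.
have di : is_diff p (fun x : X => (x, q)) (fun x => (x, 0)).
  exact: is_diff_pair.
have -> : (fun x : X => g (x, q)) = g \o (fun x => (x, q)) by [].
by rewrite [in RHS]diff_comp//= [in RHS]diff_val.
Qed.

Lemma diff_partial2 g z v : differentiable g z ->
  'd g z (0, v) = v *m partial2 g z.
Proof.
case: z => p q dg; rewrite mul_rV_lin1/=.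
have di : is_diff q (fun y : Y => (p, y)) (fun y => (0, y)).
  exact: is_diff_pair.
have -> : (fun y : Y => g (p, y)) = g \o (fun y => (p, y)) by [].
by rewrite [in RHS]diff_comp//= [in RHS]diff_val.
Qed.

Lemma diff_partials g z w : differentiable g z ->
  'd g z w = w.1 *m partial1 g z + w.2 *m partial2 g z.
Proof.
case: w => u v dg; rewrite -diff_partial1// -diff_partial2// -linearD/=.
by congr ('d g z _); rewrite -[RHS]/(_ + _, _ + _) addr0 add0r.
Qed.

Lemma cvg_partial2 (T : Type) (F : set_system T) {FF : Filter F} g
    (c : T -> Z) z :
  (\forall t \near F, differentiable g (c t)) -> differentiable g z ->
  (forall e, 'd g (c t) e @[t --> F] --> 'd g z e) ->
  partial2 g (c t) @[t --> F] --> partial2 g z.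
Proof.
move=> dc dz gc; apply: cvg_mx => i j.
have pE w : differentiable g w ->
    'd g w (0, delta_mx 0 i) 0 j = partial2 g w i j.
  by move=> dw; rewrite diff_partial2// -rowE mxE.
rewrite -[X in _ --> X](pE _ dz).
apply: cvg_trans _ (cvg_entry (i := 0) (j := j) (gc (0, delta_mx 0 i))).
apply: near_eq_cvg; near=> t; apply: pE; near: t; exact: dc.
Unshelve. all: by end_near. Qed.

End partials.

Section smooth_facts.
Context {R : realType} {V W : normedModType R} {U : set V} {g : V -> W}.
Hypotheses (hU : open U) (hg : smooth_on U g).

Lemma smooth_differentiable z : U z -> differentiable g z.
Proof. by have [gd _] := hg 1; exact: gd. Qed.

Lemma within_open_cvg (f : V -> W) z : {within U, continuous f} -> U z ->
  f @ z --> f z.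
Proof.
by rewrite continuous_open_subspace// => fc Uz; apply: fc; rewrite inE.
Qed.

Lemma smooth_diff_cvg v z : U z -> 'd g w v @[w --> z] --> 'd g z v.
Proof.
by move=> Uz; have [_ gc] := hg 1; exact: (within_open_cvg (gc v) Uz).
Qed.

Lemma smooth_diff_differentiable v z : U z ->
  differentiable (fun w => 'd g w v) z.
Proof. by move=> Uz; have [_ gc] := hg 2; have [gd _] := gc v; exact: gd. Qed.

Lemma smooth_diff2_cvg a b z : U z ->
  diff2 g w a b @[w --> z] --> diff2 g z a b.
Proof.
move=> Uz; have [_ gc] := hg 2; have [_ gcc] := gc b.
exact: (within_open_cvg (gcc a) Uz).
Qed.

(** The second derivative is linear in its first argument by definition; in the
    second one this is the linearity of differentiation applied to
    w |-> k g'(w) b + g'(w) c. *)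
Lemma diff2_linear_r z a : U z -> linear (diff2 g z a).
Proof.
move=> Uz k b c; rewrite /diff2.
have -> : (fun w => 'd g w (k *: b + c)) =
    k *: (fun w => 'd g w b) + (fun w => 'd g w c).
  by apply/funext => w; rewrite linearP.
have db := smooth_diff_differentiable b Uz.
have dc := smooth_diff_differentiable c Uz.
rewrite (congr1 (fun F => F a) (diffD (differentiableZ k db) dc)).
exact: (congr1 (fun F => F a + _) (diffZ k db)).
Qed.

End smooth_facts.

Section diff2_cvg.
Context {R : realType} {m s : nat} {W : normedModType R}.
Local Notation Z := ('rV[R]_m * 'rV[R]_s)%type.
Context {U : set Z} {g : Z -> W}.
Hypotheses (hU : open U) (hg : smooth_on U g).

(** Joint continuity of g'' in the base point and both arguments follows from
    continuity in the base point alone, by letting one argument move at a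
    time. *)
Lemma cvg_diff2 (T : Type) (F : set_system T) {FF : Filter F}
    (c a b : T -> Z) z a0 b0 :
  U z -> c @ F --> z -> a @ F --> a0 -> b @ F --> b0 ->
  diff2 g (c t) (a t) (b t) @[t --> F] --> diff2 g z a0 b0.
Proof.
move=> Uz cz aa0 bb0.
have Uc : \forall t \near F, U (c t) by apply: cz; exact: open_nbhs_nbhs.
apply: (cvg_linear_app (L := fun t => diff2 g (c t) (a t))) bb0.
- by apply: filterS Uc => t; exact: diff2_linear_r.
- exact: diff2_linear_r.
move=> e; apply: (cvg_linear_app (L := fun t v => diff2 g (c t) v e)
  (l := fun v => diff2 g z v e)) aa0.
- by apply: nearW => t; exact: (linearP ('d (fun w => 'd g w e) (c t))).
- exact: (linearP ('d (fun w => 'd g w e) z)).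
by move=> v; apply: (cvg_comp _ _ cz (smooth_diff2_cvg hU hg Uz)).
Qed.

Lemma cvg_diff (T : Type) (F : set_system T) {FF : Filter F}
    (c b : T -> Z) z b0 :
  U z -> c @ F --> z -> b @ F --> b0 ->
  'd g (c t) (b t) @[t --> F] --> 'd g z b0.
Proof.
move=> Uz cz bb0.
apply: (cvg_linear_app (L := fun t => 'd g (c t))) bb0.
- by apply: nearW => t; exact: linearP.
- exact: linearP.
by move=> e; apply: (cvg_comp _ _ cz (smooth_diff_cvg hU hg Uz)).
Qed.

End diff2_cvg.

Section smooth_partial2.
Context {R : realType} {m s : nat}.
Local Notation Y := 'rV[R]_s.
Local Notation Z := ('rV[R]_m * 'rV[R]_s)%type.
Context {U : set Z} {g : Z -> Y}.
Hypotheses (hU : open U) (hg : smooth_on U g).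

Lemma smooth_partial2_cvg (T : Type) (F : set_system T) {FF : Filter F}
    (c : T -> Z) z :
  U z -> c @ F --> z -> partial2 g (c t) @[t --> F] --> partial2 g z.
Proof.
move=> Uz cz; apply: cvg_partial2.
- have Uc : \forall t \near F, U (c t) by apply: cz; exact: open_nbhs_nbhs.
  by apply: filterS Uc => t; exact: smooth_differentiable.
- exact: smooth_differentiable Uz.
by move=> e; apply: (cvg_diff hU hg Uz cz); exact: cvg_cst.
Qed.

End smooth_partial2.

(** * Curves in the zero set *)

Section constrained_curves.
Context {R : realType} {m s : nat}.
Local Notation Y := 'rV[R]_s.
Local Notation Z := ('rV[R]_m * 'rV[R]_s)%type.
Context {U : set Z} {g : Z -> Y}.
Hypotheses (hU : open U) (hg : smooth_on U g)
  (hg2 : forall z, U z -> partial2 g z \in unitmx).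
Context {J : set R} {xi : R -> Z}.
Hypotheses (nJ : nontrivial_interval J)
  (xiM : forall t, J t -> zero_set U g (xi t)).

Lemma diff_velocity_eq0 t w : J t -> is_derive_on J xi t w -> 'd g (xi t) w = 0.
Proof.
move=> Jt xiw; have [Ut _] := xiM Jt.
have dg := is_derive_on_comp (smooth_differentiable hg Ut) xiw.
rewrite -(is_derive_on_derive nJ Jt dg).
apply: (is_derive_on_derive nJ Jt).
apply: (eq_is_derive_on (f := cst 0)) => //.
  by move=> r Jr; have [_ /= ->] := xiM Jr.
rewrite /is_derive_on/slope; under eq_cvg do rewrite subrr scaler0.
exact: cvg_cst.
Qed.

(** Since g'(xi r) (w r) = 0 for all r, the difference quotient at t splits as
    g'(xi r) (slope of w) + (slope of r |-> g'(xi r) (w t)) = 0.  The vector w t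
    is fixed in the second term, which therefore tends to g''(xi t)(w t, w t) by
    the chain rule.  Solving for the y-part of the slope of w, by inverting the
    second Jacobian at xi r, and letting r tend to t shows that the y-part of w
    is differentiable and computes its derivative. *)
Lemma acceleration_snd (w : R -> Z) t a : J t ->
  (forall r, J r -> is_derive_on J xi r (w r)) ->
  is_derive_on J (fun r => (w r).1) t a ->
  is_derive_on J (fun r => (w r).2) t
    (- ((a *m partial1 g (xi t) + diff2 g (xi t) (w t) (w t))
         *m invmx (partial2 g (xi t)))).
Proof.
move=> Jt xiw wa; have [Ut _] := xiM Jt.
have velocity r : J r -> 'd g (xi r) (w r) = 0.
  by move=> Jr; exact: diff_velocity_eq0 Jr (xiw r Jr).
have nbJ : within J t^' J by exact: withinT.
have xic : xi @ within J t^' --> xi t.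
  apply: cvg_trans _ (is_derive_on_continuous (xiw t Jt)).
  exact: cvg_app (@within_dnbhs_cvg _ J t).
have hc :=
  is_derive_on_comp (smooth_diff_differentiable hg (w t) Ut) (xiw t Jt).
have w1c : 'd g (xi r) (slope (fun r => (w r).1) t r, 0)
    @[r --> within J t^'] --> 'd g (xi t) (a, 0).
  apply: (cvg_diff hU hg Ut xic).
  have c0 : (0 : 'rV[R]_s) @[r --> within J t^'] --> (0 : 'rV[R]_s).
    exact: cvg_cst.
  exact: (cvg_pair wa c0).
have P2c : invmx (partial2 g (xi r)) @[r --> within J t^'] -->
    invmx (partial2 g (xi t)).
  by apply: cvg_invmx (hg2 Ut) _; exact: (smooth_partial2_cvg hU hg Ut xic).
rewrite -diff_partial1; last exact: smooth_differentiable Ut.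
have H := cvgN (cvg_mulmx (cvgD w1c hc) P2c). 
apply: cvg_trans _ (H _ _ _).
apply: near_eq_cvg; near=> r; rewrite !fctE.
have Jr : J r by near: r.
have [Ur _] := xiM Jr.
suff -> : 'd g (xi r) (slope (fun r => (w r).1) t r, 0) +
    slope (fun r => 'd g (xi r) (w t)) t r =
    - (slope (fun r => (w r).2) t r *m partial2 g (xi r)).
  by rewrite mulNmx opprK mulmxK ?hg2.
apply/eqP; rewrite -addr_eq0 addrAC -diff_partial2; last first.
  exact: smooth_differentiable Ur.
rewrite -linearD/=.
have -> : (slope (fun r => (w r).1) t r, 0) + (0, slope (fun r => (w r).2) t r) =
    (r - t)^-1 *: (w r - w t).
  by rewrite -[LHS]/(_ + _, _ + _) addr0 add0r.
have E1 : 'd g (xi r) ((r - t)^-1 *: (w r - w t)) =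
    - ((r - t)^-1 *: 'd g (xi r) (w t)).
  by rewrite linearZ/= linearB/= velocity// sub0r scalerN.
have E2 : slope (fun r => 'd g (xi r) (w t)) t r =
    (r - t)^-1 *: 'd g (xi r) (w t).
  by rewrite /slope [X in _ *: (_ - X)]velocity// subr0.
by apply/eqP; apply: (etrans (congr2 +%R E1 E2)); rewrite addNr.
Unshelve. all: by end_near. Qed.

End constrained_curves.

(** * Orthogonal projection onto a graph *)

Section orthogonal_projection.
Context {R : realType} {m s : nat}.
Local Notation Z := ('rV[R]_m * 'rV[R]_s)%type.
Implicit Types (a b w : Z) (K : 'M[R]_(m, s)).

Lemma dotE a b : dot a b = (a.1 *m b.1^T + a.2 *m b.2^T) 0 0.
Proof.
rewrite /dot !mxE; congr (_ + _); apply: eq_bigr => i _; by rewrite mxE.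
Qed.

Lemma dotBl a b w : dot (a - b) w = dot a w - dot b w.
Proof.
rewrite !dotE (_ : _ + _ = (a.1 *m w.1^T + a.2 *m w.2^T) -
  (b.1 *m w.1^T + b.2 *m w.2^T)); first by rewrite [LHS]mxE [X in _ + X]mxE.
by rewrite opprD addrACA -!mulmxBl.
Qed.

Lemma dot_eq0 a : dot a a = 0 -> a = 0.
Proof.
have ge0 n (v : 'rV[R]_n) : 0 <= \sum_i v 0 i * v 0 i.
  by apply: sumr_ge0 => i _; rewrite -expr2 sqr_ge0.
have eq0 n (v : 'rV[R]_n) : \sum_i v 0 i * v 0 i == 0 -> v = 0.
  rewrite psumr_eq0 => [/allP v0|i _]; last by rewrite -expr2 sqr_ge0.
  apply/rowP => i; apply/eqP; rewrite mxE -sqrf_eq0 expr2.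
  by apply: v0; rewrite mem_index_enum.
case: a => u v /eqP; rewrite /dot/= paddr_eq0; [|exact: ge0..].
by move=> /andP[/eq0-> /eq0->].
Qed.

Definition graph K : set Z := [set w | w.2 = w.1 *m K].

(** The quadratic form of this matrix at u is the squared norm of (u, u K). *)
Lemma graph_gram_unit K : 1%:M + K *m K^T \in unitmx.
Proof.
rewrite -row_free_unit -kermx_eq0; apply/eqP/row_matrixP => i; rewrite row0.
set u := row i _.
have uK : u *m (1%:M + K *m K^T) = 0.
  by apply/sub_kermxP; exact: row_sub.
have /dot_eq0 : dot (u, u *m K) (u, u *m K) = 0.
  rewrite dotE/= trmx_mul mulmxA -mulmxDl -[X in _ + X]mulmxA -{1}[u]mulmx1.
  by rewrite -mulmxDr uK mul0mx mxE.
by case.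
Qed.

(** The normal equations for the projection (u, u K) of w onto the graph are
    u (1 + K K^T) = w.1 + w.2 K^T. *)
Lemma orth_proj_graph K w : let v := orth_proj (graph K) w in
  graph K v /\ forall a, graph K a -> dot (w - v) a = 0.
Proof.
move=> v; apply: (@xgetPex _ 0 [set v | graph K v /\ _]).
pose u := (w.1 + w.2 *m K^T) *m invmx (1%:M + K *m K^T).
exists (u, u *m K); split=> // -[b c]; rewrite /graph/= => ->.
have uE : u *m (1%:M + K *m K^T) = w.1 + w.2 *m K^T.
  by rewrite mulmxKV// graph_gram_unit.
rewrite dotE/= trmx_mul mulmxA -mulmxDl mulmxBl -mulmxA.
have -> : w.1 - u + (w.2 *m K^T - u *m (K *m K^T)) = 0; last first.
  by rewrite mul0mx mxE.
by rewrite addrACA -uE mulmxDr mulmx1 -opprD subrr.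
Qed.

(** The difference of the two vectors is orthogonal to the graph, being the
    difference of their normal components, and it lies in the graph. *)
Lemma orth_proj_graph_inj K a b : graph K (a - b) ->
  orth_proj (graph K) a = orth_proj (graph K) b -> a = b.
Proof.
move=> Kab ab; have [_ aP] := orth_proj_graph K a.
have [_ bP] := orth_proj_graph K b.
apply/eqP; rewrite -subr_eq0; apply/eqP/dot_eq0.
have -> : dot (a - b) (a - b) =
    dot ((a - orth_proj (graph K) a) - (b - orth_proj (graph K) b)) (a - b).
  by rewrite ab opprB addrA subrK.
by rewrite dotBl aP// bP// subrr.
Qed.

End orthogonal_projection.

(** * The implicit function *)

Lemma is_derive_entry {R : realType} k l (M : R -> 'M[R]_(k, l)) (t : R)
    (D : 'M[R]_(k, l)) i j :
  is_derive t 1 M D -> is_derive t 1 (fun r => M r i j) (D i j).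
Proof.
case=> dM <-; split; first exact: (derivable_mxP M t 1).1.
by rewrite derive_mx// mxE.
Qed.

Section strict_differentiability.
Context {R : realType} {m s n : nat}.
Local Notation Z := ('rV[R]_m * 'rV[R]_s)%type.
Context {U : set Z} {g : Z -> 'rV[R]_n}.
Hypotheses (hU : open U) (hg : smooth_on U g).

Lemma is_derive_segment (z h b : Z) (t : R) : U (z + t *: h) ->
  is_derive t 1 (fun r : R => g (z + r *: h) - r *: 'd g b h)
    ('d g (z + t *: h) h - 'd g b h).
Proof.
move=> Ut; have dg := differentiableP (smooth_differentiable hg Ut).
have dl : is_diff t (fun r : R => z + r *: h) (fun r => r *: h).
  have -> : (fun r : R => r *: h) = 0 + (fun r : R => r *: h).
    by apply/funext => r; rewrite !fctE add0r.
  have H : is_diff t (cst z + ( *:%R^~ h : R -> Z)) (0 + ( *:%R^~ h : R -> Z)).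
    exact: is_diffD.
  exact: H.
have dM := is_diffB (is_diff_comp dl dg) (is_diff_scalel t ('d g b h)).
split; first by apply: diff_derivable; exact: ex_diff.
rewrite deriveE; last exact: ex_diff.
by rewrite (diff_val (is_diff_def := dM)) !fctE/= !scale1r.
Qed.

(** Continuity of g' at z makes the estimate of the derivative uniform in pairs
    of points near z.  The mean value theorem is applied to each coordinate of
    r |-> g (w2 + r (w1 - w2)) - r g'(z) (w1 - w2) separately: this is enough
    because the norm of row vectors is the maximum norm, even though the
    intermediate point depends on the coordinate. *)
Lemma strictly_differentiable (z : Z) (e : R) : U z -> 0 < e ->
  exists2 r : R, 0 < r & (forall w, `|z - w| < r -> U w) /\
   forall w1 w2, `|z - w1| < r -> `|z - w2| < r ->
    `|g w1 - g w2 - 'd g z (w1 - w2)| <= e * `|w1 - w2|.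
Proof.
move=> Uz e0.
have : \forall w \near z, U w /\
    opbound (('d g w : Z -> 'rV[R]_n) - ('d g z : Z -> 'rV[R]_n)) <= e.
  have gc v : 'd g w v @[w --> z] --> 'd g z v := smooth_diff_cvg hU hg Uz.
  have O : opbound (('d g w : Z -> 'rV[R]_n) - ('d g z : Z -> 'rV[R]_n))
      @[w --> z] --> (0 : R).
    exact: (opbound_cvg0 (L := fun w => 'd g w)).
  have Oe := (cvgr0Pnorm_le _).1 O e e0.
  near=> w; split; first by near: w; exact: open_nbhs_nbhs.
  by rewrite (le_trans (ler_norm _))//; near: w; exact: Oe.
move=> /nbhs_normP[r /= r0 rU]; exists r => //; split=> [w zw|w1 w2 zw1 zw2].
  by have [] := rU w zw.
set h := w1 - w2.
have seg t : 0 <= t <= 1 -> `|z - (w2 + t *: h)| < r.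
  move=> /andP[t0 t1].
  have -> : z - (w2 + t *: h) = (1 - t) *: (z - w2) + t *: (z - w1).
    have -> : z - w1 = z - w2 - h by rewrite /h opprB addrA subrK.
    by rewrite scalerBl scale1r (scalerBr t (z - w2)) addrA subrK opprD addrA.
  rewrite (le_lt_trans (ler_normD _ _))// !normrZ.
  rewrite ger0_norm ?subr_ge0// (ger0_norm t0).
  have [/eqP t00|tn0] := boolP (t == 0).
    by rewrite t00 subr0 mul1r mul0r addr0.
  have tp : 0 < t by rewrite lt_def tn0.
  have -> : r = (1 - t) * r + t * r by rewrite -mulrDl subrK mul1r.
  rewrite ler_ltD// ?ltr_pM2l// ler_wpM2l ?subr_ge0// ltW//.
apply: mx_norm_le => [|i j]; first by rewrite mulr_ge0// ltW.
pose M := fun t : R => g (w2 + t *: h) - t *: 'd g z h.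
pose D := fun t : R => 'd g (w2 + t *: h) h - 'd g z h.
have dM (t : R) : 0 <= t <= 1 -> is_derive t 1 (fun r => M r i j) (D t i j).
  move=> t01; apply: is_derive_entry; apply: is_derive_segment.
  by have [] := rU _ (seg t t01).
have [c c01 Mc] : exists2 c, c \in `]0, 1[%R &
    M 1 i j - M 0 i j = D c i j * (1 - 0).
  apply: (@MVT _ (fun r => M r i j) (fun r => D r i j)) => //.
    move=> x; rewrite in_itv/= => /andP[/ltW x0 /ltW x1].
    by apply: dM; rewrite x0.
  apply: derivable_within_continuous => x; rewrite in_itv/= => x01.
  by have [] := dM x x01.
have -> : (g w1 - g w2 - 'd g z h) i j = M 1 i j - M 0 i j.
  rewrite /M !scale0r addr0 subr0 !scale1r /h [w2 + _]addrC subrK.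
  by rewrite ![in RHS]mxE ![in LHS]mxE addrAC.
rewrite Mc subr0 mulr1 (le_trans (le_mx_norm_entry _ i j))//.
move: c01; rewrite in_itv/= => /andP[/ltW c0 /ltW c1].
have [_ oc] := rU _ (seg c (introT andP (conj c0 c1))).
apply: (le_trans (linear_le_opbound
  (f := ('d g (w2 + c *: h) : Z -> 'rV[R]_n) - ('d g z : Z -> 'rV[R]_n)) h _)).
  by apply: linear_sub; exact: linearP.
by rewrite ler_wpM2r.
Unshelve. all: by end_near. Qed.

End strict_differentiability.

(** Joins completeness with the norm, so that the fixed point theorem for
    contractions of complete normed modules applies to matrices. *)
HB.instance Definition _ (R : realType) (m n : nat) := Complete.on 'M[R]_(m, n).

Section implicit_function.
Context {R : realType} {m s : nat}.
Local Notation X := 'rV[R]_m.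
Local Notation Y := 'rV[R]_s.
Local Notation Z := ('rV[R]_m * 'rV[R]_s)%type.
Context {U : set Z} {g : Z -> Y}.
Hypotheses (hU : open U) (hg : smooth_on U g)
  (hg2 : forall z, U z -> partial2 g z \in unitmx).

(** Banach's theorem on a closed ball, with explicit norm estimates in place of
    bundled functions. *)
Lemma contraction_fixed_point (q : Y) (rho : R) (f : Y -> Y) : 0 < rho ->
  (forall y, `|q - y| <= rho -> `|q - f y| <= rho) ->
  (forall y1 y2, `|q - y1| <= rho -> `|q - y2| <= rho ->
    `|f y1 - f y2| <= 2^-1 * `|y1 - y2|) ->
  exists2 y, `|q - y| <= rho & y = f y.
Proof.
move=> r0 fD fc; pose D := closed_ball q rho.
have DE : D = [set y | `|q - y| <= rho] by rewrite /D closed_ballE.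
have fDD : set_fun D D f by rewrite DE.
pose fM := isFun.Build _ _ D D f fDD.
pose F : {fun D >-> D} := HB.pack f fM.
have h0 : 0 <= 2^-1 :> R by rewrite invr_ge0.
have Fc : is_contraction F.
  exists (NngNum h0); split => /=; first by rewrite invf_lt1// ltr1n.
  by rewrite DE => -[y1 y2] [/= Dy1 Dy2]; exact: fc.
have [||y Dy yF] := banach_fixed_point Fc.
- exact: closed_ball_closed.
- by exists q; rewrite DE /= subrr normr0 ltW.
by exists y => //; move: Dy; rewrite DE.
Qed.

(** The value phi x is the fixed point of the simplified Newton map
    T x y = y - g (x, y) P2^-1, where P2 is taken at z.  By strict
    differentiability T x is a contraction with factor 1/2 near z.2, uniformly
    in x, and T is Lipschitz in x.  The Lipschitz bound for phi follows from
    |phi x1 - phi x2| <= |T x1 (phi x1) - T x1 (phi x2)|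
                         + |T x1 (phi x2) - T x2 (phi x2)|
    by absorbing the first term, which is at most half of the left-hand side. *)
Lemma implicit_function z : zero_set U g z ->
  exists (e k : R) (phi : X -> Y), [/\ 0 < e, 0 <= k, phi z.1 = z.2,
    forall x, `|z.1 - x| < e -> zero_set U g (x, phi x) &
    forall x1 x2, `|z.1 - x1| < e -> `|z.1 - x2| < e ->
      `|phi x1 - phi x2| <= k * `|x1 - x2|].
Proof.
case: z => p q [/= Uz gz]; set z := (p, q) in Uz gz *.
pose A := partial2 g z; pose B := invmx A.
pose C := opbound (fun w : Z => w.2 *m B).
have C0 : 0 <= C := opbound_ge0 _.
have CB (v : Y) : `|v *m B| <= C * `|v|.
  have := @linear_le_opbound R m s _ (fun w : Z => w.2 *m B) (0, v).
  rewrite [X in _ <= _ * X]prod_normE/= normr0 (max_idPr _)//; apply.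
  by move=> c w1 w2; rewrite /= mulmxDl scalemxAl.
(* The C + 1 in place of C keeps the denominator positive; then C eps <= 1/2. *)
pose eps := (2 * (C + 1))^-1.
have C1 : 0 < C + 1 by rewrite ltr_wpDl.
have eps0 : 0 < eps by rewrite invr_gt0 mulr_gt0.
have Ceps : C * eps <= 2^-1.
  rewrite /eps invfM mulrCA -[leRHS]mulr1 ler_wpM2l ?invr_ge0//.
  by rewrite ler_pdivrMr// mul1r lerDl.
have [r r0 [rU rg]] := strictly_differentiable hU hg Uz eps0.
pose L := opbound ('d g z) + eps.
have L0 : 0 < L by rewrite ltr_wpDl// opbound_ge0.
have gL w1 w2 : `|z - w1| < r -> `|z - w2| < r ->
    `|g w1 - g w2| <= L * `|w1 - w2|.
  move=> zw1 zw2; rewrite -(subrK ('d g z (w1 - w2)) (g w1 - g w2)).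
  rewrite (le_trans (ler_normD _ _))// addrC mulrDl lerD ?rg//.
  by apply: linear_le_opbound; exact: linearP.
pose T x y := y - g (x, y) *m B.
have TcY x y1 y2 : `|p - x| < r -> `|q - y1| < r -> `|q - y2| < r ->
    `|T x y1 - T x y2| <= 2^-1 * `|y1 - y2|.
  move=> px qy1 qy2.
  have zy1 : `|z - (x, y1)| < r by exact: ball_pair.
  have zy2 : `|z - (x, y2)| < r by exact: ball_pair.
  have dE : (x, y1) - (x, y2) = (0, y1 - y2).
    by rewrite -[LHS]/(_ - _, _ - _) subrr.
  have := rg _ _ zy1 zy2.
  rewrite dE diff_partial2; last exact: smooth_differentiable Uz.
  rewrite [X in _ <= _ * X]prod_normE/= normr0 (max_idPr _)// => rgy.
  have -> : T x y1 - T x y2 =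
      - ((g (x, y1) - g (x, y2) - (y1 - y2) *m partial2 g z) *m B).
    rewrite mulmxBl -/A mulmxK ?hg2// mulmxBl /T !opprB.
    by rewrite [LHS]addrACA [RHS]addrACA (addrC (- (g (x, y1) *m B))).
  rewrite normrN (le_trans (CB _))//.
  rewrite (le_trans (ler_wpM2l C0 rgy))// mulrA ler_wpM2r//.
have TcX x1 x2 y : `|p - x1| < r -> `|p - x2| < r -> `|q - y| < r ->
    `|T x1 y - T x2 y| <= C * L * `|x1 - x2|.
  move=> px1 px2 qy.
  have zy1 : `|z - (x1, y)| < r by exact: ball_pair.
  have zy2 : `|z - (x2, y)| < r by exact: ball_pair.
  have -> : T x1 y - T x2 y = (g (x2, y) - g (x1, y)) *m B.
    by rewrite mulmxBl /T opprB addrC subrKA.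
  rewrite (le_trans (CB _))// -mulrA ler_wpM2l// (le_trans (gL _ _ zy2 zy1))//.
  have -> : (x2, y) - (x1, y) = (x2 - x1, 0).
    by rewrite -[LHS]/(_ - _, _ - _) subrr.
  by rewrite prod_normE/= normr0 (max_idPl _)// distrC.
have Tq : T p q = q by rewrite /T gz mul0mx subr0.
(* For |p - x| < e the map T x moves q by at most r / 4, hence maps the closed
   ball of radius r / 2 around q to itself. *)
pose e := Num.min r (r / 4 / (C * L + 1)).
have CL1 : 0 < C * L + 1 by rewrite ltr_wpDl// mulr_ge0// ltW.
have e0 : 0 < e by rewrite lt_min r0/= !divr_gt0.
have er : e <= r by rewrite ge_min lexx.
have rho0 : 0 < r / 2 by rewrite divr_gt0.
have rho_r : r / 2 < r by rewrite ltr_pdivrMr// ltr_pMr// ltr1n.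
have fix_exists x : exists y, `|p - x| < e -> `|q - y| <= r / 2 /\ y = T x y.
  have [px|] := ltP `|p - x| e; last by exists 0.
  have pxr := lt_le_trans px er.
  have pp : `|p - p| < r by rewrite subrr normr0.
  have qq : `|q - q| < r by rewrite subrr normr0.
  have [||y qy yT] := @contraction_fixed_point q (r / 2) (T x) rho0.
  - move=> y qy; rewrite -{1}Tq -(subrKA (T x q)) (le_trans (ler_normD _ _))//.
    have -> : r / 2 = r / 4 + r / 4 by lra.
    rewrite lerD//.
      rewrite (le_trans (TcX _ _ _ pp pxr qq))//.
      have : `|p - x| <= r / 4 / (C * L + 1).
        by rewrite (le_trans (ltW px))// ge_min lexx orbT.
      rewrite ler_pdivlMr// => h; apply: le_trans h.
      by rewrite mulrC ler_wpM2l// lerDl.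
    rewrite (le_trans (TcY _ _ _ pxr qq (le_lt_trans qy rho_r)))//.
    by move: qy; lra.
  - move=> y1 y2 /le_lt_trans/(_ rho_r) qy1 /le_lt_trans/(_ rho_r) qy2.
    exact: TcY.
  by exists y.
have [phi phiP] := choice fix_exists.
have phi_lip x1 x2 : `|p - x1| < e -> `|p - x2| < e ->
   `|phi x1 - phi x2| <= 2 * (C * L) * `|x1 - x2|.
  move=> px1 px2; have [qy1 y1T] := phiP _ px1; have [qy2 y2T] := phiP _ px2.
  have px1r := lt_le_trans px1 er; have px2r := lt_le_trans px2 er.
  have y1r := le_lt_trans qy1 rho_r; have y2r := le_lt_trans qy2 rho_r.
  have := TcY x1 _ _ px1r y1r y2r; have := TcX _ _ _ px1r px2r y2r.
  have : `|phi x1 - phi x2| <= `|T x1 (phi x1) - T x1 (phi x2)| +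
      `|T x1 (phi x2) - T x2 (phi x2)|.
    by rewrite {1}y1T {1}y2T -(subrKA (T x1 (phi x2))) ler_normD.
  by lra.
exists e, (2 * (C * L)), phi; split=> //=.
- by rewrite !mulr_ge0// ltW.
- have pp : `|p - p| < e by rewrite subrr normr0.
  have [qy yT] := phiP _ pp.
  have qq : `|q - q| < r by rewrite subrr normr0.
  have := TcY p _ _ (lt_le_trans pp er) (le_lt_trans qy rho_r) qq.
  rewrite -yT Tq => h; apply/eqP; rewrite -subr_eq0 -normr_le0.
  by lra.
- move=> x px; have [qy yT] := phiP _ px; split=> /=.
    apply: rU; apply: ball_pair; first exact: lt_le_trans px er.
    exact: le_lt_trans qy rho_r.
  move/eqP: yT; rewrite /T -subr_eq0 opprB addrC subrK => /eqP gB.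
  by rewrite -(mulmxKV (hg2 Uz) (g _)) -/A -/B gB mul0mx.
Qed.

End implicit_function.

(** * The tangent space of the zero set *)

Section tangent_spaces.
Context {R : realType} {m s : nat}.
Local Notation X := 'rV[R]_m.
Local Notation Y := 'rV[R]_s.
Local Notation Z := ('rV[R]_m * 'rV[R]_s)%type.
Context {U : set Z} {g : Z -> Y}.
Hypotheses (hU : open U) (hg : smooth_on U g)
  (hg2 : forall z, U z -> partial2 g z \in unitmx).

(** The derivative of the implicit function of g at z. *)
Definition implicit_jacobian z : 'M[R]_(m, s) :=
  - (partial1 g z *m invmx (partial2 g z)).

Lemma kernel_graph z w : U z -> 'd g z w = 0 <-> graph (implicit_jacobian z) w.
Proof.
move=> Uz; rewrite diff_partials; last exact: smooth_differentiable Uz.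
rewrite /graph/= /implicit_jacobian mulmxN mulmxA; split=> [/eqP|->].
  rewrite addrC addr_eq0 => /eqP wE.
  by rewrite -mulNmx -wE mulmxK ?hg2.
by rewrite mulNmx mulmxKV ?hg2// subrr.
Qed.

Lemma cvg_implicit_jacobian (T : Type) (F : set_system T) {FF : Filter F}
    (c : T -> Z) z (u : X) : U z -> c @ F --> z ->
  u *m implicit_jacobian (c t) @[t --> F] --> u *m implicit_jacobian z.
Proof.
move=> Uz cz.
have Uc : \forall t \near F, U (c t) by apply: cz; exact: open_nbhs_nbhs.
have uE w : U w ->
    - ('d g w (u, 0) *m invmx (partial2 g w)) = u *m implicit_jacobian w.
  move=> Uw; rewrite diff_partial1; last exact: smooth_differentiable Uw.
  by rewrite /implicit_jacobian mulmxN mulmxA.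
have u0 : (u, 0 : Y) @[t --> F] --> (u, 0 : Y) by exact: cvg_cst.
have P2c : invmx (partial2 g (c t)) @[t --> F] --> invmx (partial2 g z).
  by apply: cvg_invmx (hg2 Uz) _; exact: (smooth_partial2_cvg hU hg Uz cz).
have Lc : 'd g (c t) (u, 0) @[t --> F] --> 'd g z (u, 0).
  exact: (cvg_diff hU hg Uz cz u0).
have H : - ('d g (c t) (u, 0) *m invmx (partial2 g (c t))) @[t --> F] -->
    - ('d g z (u, 0) *m invmx (partial2 g z)).
  by apply: cvgN; apply: cvg_mulmx.
rewrite -[X in _ --> X](uE z Uz); apply: cvg_trans _ H.
by apply: near_eq_cvg; apply: filterS Uc => t /uE.
Qed.

(** Differentiability of g gives g'(z) (slope of (x, y)) = o(1), because g
    vanishes along the curve and the Lipschitz bound on y keeps the slope of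
    (x, y) bounded.  The slope of y is recovered from this by inverting the
    second Jacobian at z. *)
Lemma is_derive_on_implicit (J : set R) (x : R -> X) (y : R -> Y) t u k :
  J t -> (forall r, J r -> zero_set U g (x r, y r)) ->
  is_derive_on J x t u ->
  (forall r, J r -> `|y r - y t| <= k * `|x r - x t|) ->
  is_derive_on J y t (u *m implicit_jacobian (x t, y t)).
Proof.
move=> Jt cM xu ylip; have [/= Ut gt0] := cM t Jt.
pose z := (x t, y t).
have dg : differentiable g z := smooth_differentiable hg Ut.
have nJ : \forall r \near within J t^', J r by exact: withinT.
have sxb : \forall r \near within J t^', `|slope x t r| <= `|u| + 1.
  by apply: (cvgr_norm_le u xu); rewrite ltrDl.
pose M := (`|k| + 1) * (`|u| + 1).
have M0 : 0 < M by rewrite mulr_gt0// ltr_wpDl.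
have xc := is_derive_on_continuous xu.
have yc : y @ within J (nbhs t) --> y t.
  apply: cvg_sub0 (cvg_cst (y t)).
  have x0 : `|k| * `|x r - x t| @[r --> within J (nbhs t)] --> (0 : R).
    rewrite -(mulr0 `|k|) -(@normr0 _ X) -(subrr (x t)).
    apply: cvgM; first exact: cvg_cst.
    by apply: cvg_norm; apply: cvgB xc _; exact: cvg_cst.
  apply/norm_cvg0P; apply: squeeze_cvgr (cvg_cst (0 : R)) x0.
  near=> r; rewrite normr_ge0/= !fctE.
  have Jr : J r by near: r; exact: withinT.
  by rewrite (le_trans (ylip r Jr))// ler_wpM2r// ler_norm.
pose c r := (x r, y r).
have cc : c @ within J t^' --> z.
  apply: cvg_trans (cvg_app c (@within_dnbhs_cvg _ J t)) _.
  exact: (cvg_pair xc yc).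
have scb : \forall r \near within J t^', `|slope c t r| <= M.
  near=> r; have Jr : J r by near: r.
  have sx : `|slope x t r| <= `|u| + 1 by near: r.
  have sy : `|slope y t r| <= `|k| * `|slope x t r|.
    rewrite /slope !normrZ mulrCA ler_wpM2l//.
    by rewrite (le_trans (ylip r Jr))// ler_wpM2r// ler_norm.
  rewrite -[slope c t r]/(slope x t r, slope y t r) prod_normE/= ge_max.
  rewrite (le_trans sy)/= ?andbT; last first.
    by rewrite /M ler_pM// lerDl.
  by rewrite (le_trans sx)// /M ler_peMl// ?lerDr// addr_ge0.
have Lsc : 'd g z (slope c t r) @[r --> within J t^'] --> (0 : Y).
  apply/cvgr0Pnorm_le => e e0.
  have eM : 0 < e / M by rewrite divr_gt0.
  have := cc _ (diff_near dg eM) => near_z.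
  near=> r; have Jr : J r by near: r.
  have -> : 'd g z (slope c t r) = (r - t)^-1 *: 'd g z (c r - z).
    by rewrite /slope linearZ.
  have [/= _ gr0] := cM r Jr.
  have : `|g (c r) - g z - 'd g z (c r - z)| <= e / M * `|c r - z|.
    by near: r; exact: near_z.
  rewrite gr0 gt0 subrr sub0r normrN => gz.
  rewrite normrZ (le_trans (ler_wpM2l _ gz))// mulrCA -normrZ.
  apply: (@le_trans _ _ (e / M * M)); last by rewrite divfK// gt_eqF.
  by apply: ler_wpM2l; [exact: ltW|near: r].
have sxc : 'd g z (slope x t r, 0) @[r --> within J t^'] --> 'd g z (u, 0).
  have c0 : (0 : Y) @[r --> within J t^'] --> (0 : Y) by exact: cvg_cst.
  have dc : continuous ('d g z) by exact: diff_continuous.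
  exact: (cvg_comp _ _ (cvg_pair xu c0) (dc (u, 0))).
have H : ('d g z (slope c t r) - 'd g z (slope x t r, 0))
    *m invmx (partial2 g z)
   @[r --> within J t^'] --> (0 - 'd g z (u, 0)) *m invmx (partial2 g z).
  apply: cvg_mulmx; [exact: cvgB|exact: cvg_cst].
have -> : u *m implicit_jacobian z =
    (0 - 'd g z (u, 0)) *m invmx (partial2 g z).
  by rewrite diff_partial1// /implicit_jacobian mulmxN mulmxA sub0r mulNmx.
apply: cvg_trans _ H; apply: near_eq_cvg; apply: nearW => r.
rewrite diff_partials// diff_partial1//.
rewrite -[slope c t r]/(slope x t r, slope y t r).
by rewrite /= addrAC subrr add0r mulmxK ?hg2.
Unshelve. all: by end_near. Qed.

Lemma tangent_space_graph z : zero_set U g z ->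
  tangent_space (zero_set U g) z = graph (implicit_jacobian z).
Proof.
move=> Mz; have [Uz _] := Mz; apply/seteqP; split=> [w|[u v] /= uv].
  move=> [e [c [e0 [cd _] cM c0 cw]]].
  have J0 : [set` `]-e, e[] 0 by rewrite /= in_itv/= oppr_lt0 e0.
  apply/kernel_graph => //; rewrite -c0.
  apply: (diff_velocity_eq0 hg (oo_nontrivial_interval e0)) => //.
  by rewrite -cw; exact: derivable_is_derive_on (cd _ J0).
(* The curve over the segment p + t u, for t small enough for the segment to
   stay in the domain of the implicit function; u may be 0, hence |u| + 1. *)
have [e [k [phi [e0 k0 phi0 phiM phi_lip]]]] := implicit_function hU hg hg2 Mz.
pose d := e / (`|u| + 1).
have u1 : 0 < `|u| + 1 by rewrite ltr_wpDl.
have d0 : 0 < d by rewrite divr_gt0.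
pose J := [set` `]-d, d[] : set R.
have nJ : nontrivial_interval J := oo_nontrivial_interval d0.
pose x t : X := z.1 + t *: u.
pose c t := (x t, phi (x t)).
have xe t : J t -> `|z.1 - x t| < e.
  rewrite /J/= in_itv/= -ltr_norml => td.
  rewrite /x opprD addrA subrr sub0r normrN normrZ.
  apply: (@le_lt_trans _ _ (`|t| * (`|u| + 1))).
    by rewrite ler_wpM2l// lerDl.
  by rewrite -ltr_pdivlMr.
have cM t : J t -> zero_set U g (c t) by move=> Jt; apply: phiM; exact: xe.
have cd t : J t -> is_derive_on J c t (u, u *m implicit_jacobian (c t)).
  move=> Jt; apply: is_derive_on_pair; first exact: is_derive_on_affine.
  apply: (is_derive_on_implicit (k := k)) => //.
    exact: is_derive_on_affine.
  by move=> r Jr; apply: phi_lip; exact: xe.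
have J0 : J 0 by rewrite /J/= in_itv/= oppr_lt0 d0.
have c0 : c 0 = z by rewrite /c /x scale0r addr0 phi0; case: (z).
have cE t : J t -> derive_on J c t = (u, u *m implicit_jacobian (c t)).
  by move=> Jt; exact: is_derive_on_derive (cd t Jt).
exists d, c; split=> //; last by rewrite -/J cE// c0 -uv.
split=> [t Jt|]; first exact: is_derive_on_derivable (cd t Jt).
apply: eq_within_continuous cE _ => t Jt; have [Ut _] := cM t Jt.
have uc : u @[r --> within J (nbhs t)] --> u by exact: cvg_cst.
have cc := is_derive_on_continuous (cd t Jt).
have kc : u *m implicit_jacobian (c r) @[r --> within J (nbhs t)] -->
    u *m implicit_jacobian (c t).
  exact: cvg_implicit_jacobian Ut cc.
exact: (cvg_pair uc kc).
Qed.

End tangent_spaces.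

(** * Equivalence of the two equations *)

Lemma cvg_into_within (S T : Type) (F : set_system S) {FF : Filter F}
    (G : set_system T) (B : set T) (f : S -> T) :
  f @ F --> G -> (\forall r \near F, B (f r)) -> f @ F --> within B G.
Proof. by move=> fG fB P BP; apply: filterS2 fB (fG _ BP) => r Br; apply. Qed.

Section equivalence.
Context {R : realType} {m s : nat}.
Local Notation X := 'rV[R]_m.
Local Notation Y := 'rV[R]_s.
Local Notation Z := ('rV[R]_m * 'rV[R]_s)%type.
Context {U : set Z} {g : Z -> Y} {E : R * (Z * Z) -> X}.
Hypotheses (hU : open U) (hg : smooth_on U g)
  (hg2 : forall z, U z -> partial2 g z \in unitmx).

(** Stated along curves because E is continuous only relative to its domain:
    the convergence of E is left as a hypothesis. *)
Lemma cvg_Etilde (T : Type) (F : set_system T) {FF : Filter F}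
    (r : T -> R) (c w : T -> Z) (r0 : R) (z w0 : Z) : U z ->
  c @ F --> z -> w @ F --> w0 ->
  E (r t, (c t, w t)) @[t --> F] --> E (r0, (z, w0)) ->
  Etilde g E (r t, (c t, w t)) @[t --> F] --> Etilde g E (r0, (z, w0)).
Proof.
move=> Uz cz ww0 Ec.
have Uc : \forall t \near F, U (c t) by apply: cz; exact: open_nbhs_nbhs.
have c0 : (0 : Y) @[t --> F] --> (0 : Y) by exact: cvg_cst.
have P2c : invmx (partial2 g (c t)) @[t --> F] --> invmx (partial2 g z).
  by apply: cvg_invmx (hg2 Uz) _; exact: (smooth_partial2_cvg hU hg Uz cz).
have P1c : 'd g (c t) (E (r t, (c t, w t)), 0) @[t --> F] -->
    'd g z (E (r0, (z, w0)), 0).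
  have pc : (E (r t, (c t, w t)), 0 : Y) @[t --> F] -->
      (E (r0, (z, w0)), 0 : Y).
    exact: (cvg_pair Ec c0).
  exact: (cvg_diff hU hg Uz cz pc).
have D2c : diff2 g (c t) (w t) (w t) @[t --> F] --> diff2 g z w0 w0.
  exact: (cvg_diff2 hU hg Uz cz ww0 ww0).
have S : - (('d g (c t) (E (r t, (c t, w t)), 0) + diff2 g (c t) (w t) (w t))
     *m invmx (partial2 g (c t))) @[t --> F] -->
   - (('d g z (E (r0, (z, w0)), 0) + diff2 g z w0 w0) *m invmx (partial2 g z)).
  by apply: cvgN; apply: cvg_mulmx => //; exact: cvgD.
have EE (q : R) (p v : Z) : U p -> Etilde g E (q, (p, v)) =
    (E (q, (p, v)), - (('d g p (E (q, (p, v)), 0) + diff2 g p v v)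
      *m invmx (partial2 g p))).
  by move=> Up; rewrite diff_partial1//; exact: smooth_differentiable Up.
rewrite [X in _ --> X](EE r0 z w0 Uz).
apply: cvg_trans _ (cvg_pair Ec S).
by apply: near_eq_cvg; apply: filterS Uc => t Ut; rewrite -(EE _ _ _ Ut).
Qed.

Context {J : set R} {x : R -> X} {y : R -> Y}.
Let xi t : Z := (x t, y t).
Hypothesis (hE : {within [set: R] `*` (U `*` [set: Z]), continuous E}).

(** The acceleration of a solution is Etilde, so its projection is that of
    Etilde; the work is in showing that the solution is C^2. *)
Lemma dae_ode : dae_solution U g E J x y ->
  ode_solution (zero_set U g) (Etilde g E) J xi.
Proof.
move=> [nJ [xd _] [yd _] sol].
have xiM t : J t -> zero_set U g (xi t) by move=> /sol[].
pose w t : Z := (derive_on J x t, derive_on J y t).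
have xiw t : J t -> is_derive_on J xi t (w t).
  by move=> Jt; exact: is_derive_on_pair (xd t Jt) (yd t Jt).
have xiE t : J t -> derive_on J xi t = w t.
  by move=> Jt; exact: is_derive_on_derive (xiw t Jt).
have ww t : J t -> is_derive_on J w t (Etilde g E (t, (xi t, w t))).
  move=> Jt; have [_ xdd xE _] := sol t Jt.
  have w1 : is_derive_on J (fun r => (w r).1) t (E (t, (xi t, w t))).
    by rewrite -xE; exact: derivable_is_derive_on xdd.
  exact: is_derive_on_pair w1 (acceleration_snd hU hg hg2 nJ xiM Jt xiw w1).
have xiww t : J t ->
    is_derive_on J (derive_on J xi) t (Etilde g E (t, (xi t, w t))).
  move=> Jt; apply: eq_is_derive_on (ww t Jt) => // r Jr.
  by rewrite xiE.
have xiEE t : J t ->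
    derive_on J (derive_on J xi) t = Etilde g E (t, (xi t, w t)).
  by move=> Jt; exact: is_derive_on_derive (xiww t Jt).
have xicont t : J t -> xi @ within J (nbhs t) --> xi t.
  by move=> Jt; exact: is_derive_on_continuous (xiw t Jt).
have wcont t : J t -> w @ within J (nbhs t) --> w t.
  by move=> Jt; exact: is_derive_on_continuous (ww t Jt).
have Econt t : J t ->
    E (r, (xi r, w r)) @[r --> within J (nbhs t)] --> E (t, (xi t, w t)).
  move=> Jt; have Ut := (xiM t Jt).1.
  have Et := (subspace_continuousP _ _).1 hE
    (t, (xi t, w t)) (conj I (conj Ut I)).
  have ac : (r, (xi r, w r)) @[r --> within J (nbhs t)] --> (t, (xi t, w t)).
    have ic : r @[r --> within J (nbhs t)] --> t by exact: cvg_within.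
    exact: (cvg_pair ic (cvg_pair (xicont t Jt) (wcont t Jt))).
  apply: cvg_comp Et; apply: cvg_into_within ac _.
  near=> r; have Jr : J r by near: r; exact: withinT.
  by split=> //; split=> //; exact: (xiM r Jr).1.
split=> //.
- split; split.
  + by move=> t Jt; exact: is_derive_on_derivable (xiw t Jt).
  + exact: eq_within_continuous xiE wcont.
  + by move=> t Jt; exact: is_derive_on_derivable (xiww t Jt).
  + apply: eq_within_continuous xiEE _ => t Jt; have Ut := (xiM t Jt).1.
    exact: (cvg_Etilde Ut (xicont t Jt) (wcont t Jt) (Econt t Jt)).
- by move=> t Jt; rewrite xiEE// xiE.
Unshelve. all: by end_near. Qed.

(** The acceleration and Etilde differ by (a, a K), with K the implicit Jacobian
    and a the defect x'' - E of the first equation, so that equality of the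
    projections forces a = 0. *)
Lemma ode_dae : ode_solution (zero_set U g) (Etilde g E) J xi ->
  dae_solution U g E J x y.
Proof.
move=> [nJ [[xid _] [xidd _]] xiM sol].
pose w := derive_on J xi.
have xiw t : J t -> is_derive_on J xi t (w t) by move=> /xid.
have xw t : J t -> is_derive_on J x t (w t).1.
  by move=> /xiw; exact: is_derive_on_fst.
have yw t : J t -> is_derive_on J y t (w t).2.
  by move=> /xiw; exact: is_derive_on_snd.
have xE t : J t -> derive_on J x t = (w t).1.
  by move=> Jt; exact: is_derive_on_derive (xw t Jt).
have yE t : J t -> derive_on J y t = (w t).2.
  by move=> Jt; exact: is_derive_on_derive (yw t Jt).
pose a := derive_on J w.
have wa t : J t -> is_derive_on J w t (a t) by move=> /xidd.
have wcont t : J t -> w @ within J (nbhs t) --> w t.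
  by move=> Jt; exact: is_derive_on_continuous (wa t Jt).
have aE t : J t -> a t = Etilde g E (t, (xi t, w t)).
  move=> Jt; have Ut := (xiM t Jt).1.
  have a1 := is_derive_on_fst (wa t Jt).
  have a2 : (a t).2 = - (((a t).1 *m partial1 g (xi t) +
        diff2 g (xi t) (w t) (w t))
         *m invmx (partial2 g (xi t))).
    rewrite -(is_derive_on_derive nJ Jt (is_derive_on_snd (wa t Jt))).
    apply: is_derive_on_derive => //.
    exact: (acceleration_snd hU hg hg2 nJ xiM Jt xiw a1).
  have := sol t Jt; rewrite (tangent_space_graph hU hg hg2 (xiM t Jt)).
  apply: orth_proj_graph_inj.
  rewrite /graph /implicit_jacobian /Etilde/=.
  rewrite a2 opprK addrC -mulmxBl opprD addrACA subrr addr0 -mulmxBl.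
  by rewrite mulmxN mulmxA -!mulNmx opprB.
split=> //.
- split=> [t Jt|]; first exact: is_derive_on_derivable (xw t Jt).
  apply: eq_within_continuous xE _ => t Jt.
  exact: (cvg_comp _ _ (wcont t Jt) cvg_fst).
- split=> [t Jt|]; first exact: is_derive_on_derivable (yw t Jt).
  apply: eq_within_continuous yE _ => t Jt.
  exact: (cvg_comp _ _ (wcont t Jt) cvg_snd).
move=> t Jt; have [Ut gt0] := xiM t Jt.
have xdd : is_derive_on J (derive_on J x) t (a t).1.
  apply: eq_is_derive_on (is_derive_on_fst (wa t Jt)) => // r Jr.
  by rewrite xE.
split=> //; first exact: is_derive_on_derivable xdd.
rewrite (is_derive_on_derive nJ Jt xdd) aE// xE// yE//.
by rewrite /Etilde/=; case: (w t).
Qed.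

End equivalence.

Theorem proposition5p1 (R : realType) (m s : nat)
    (U : set ('rV[R]_m * 'rV[R]_s)%type)
    (g : 'rV[R]_m * 'rV[R]_s -> 'rV[R]_s)
    (E : R * (('rV[R]_m * 'rV[R]_s) * ('rV[R]_m * 'rV[R]_s)) -> 'rV[R]_m)
    (hU : open U)
    (hg : smooth_on U g)
    (hg2 : forall z, U z -> partial2 g z \in unitmx)
    (hE : {within [set: R] `*` (U `*` [set: ('rV[R]_m * 'rV[R]_s)%type]),
             continuous E}) :
  forall (J : set R) (x : R -> 'rV[R]_m) (y : R -> 'rV[R]_s),
    dae_solution U g E J x y <->
    ode_solution (zero_set U g) (Etilde g E) J (fun t => (x t, y t)).
Proof. by move=> J x y; split; [exact: dae_ode|exact: ode_dae]. Qed.
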